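(* Fix $n\in\mathbb N$, $n\ge1$, and let $x_{\mathbb Z}(s)$, $s\in\mathcal S^n=\{0,1,2,3\}^n$, be the $n$-humped homoclinic orbits of the Hénon map at $\tilde\lambda=0.35$, $\cong$ the equivalence relation on $\mathcal S^n$, and $G$ the labeled graph on $\mathcal S^n$, all described in the context. Assume the following hypothesis: the connected components of $n$-humped orbits, and thus the equivalence classes of $\cong$, are in one-to-one correspondence to a partition of $G$ into disjoint $LR$-cycles; that is, there is a family of pairwise vertex-disjoint $LR$-cycles in $G$ covering all vertices such that the equivalence classes of $\cong$ are exactly the vertex sets of these cycles. Then all $n$-humped orbits lie on cycles (of this partition) whose length is a multiple of $4$. Moreover, for the symbols $s^0=(0,\dots,0)$ and $s^2=(2,\dots,2)$ in $\mathcal S^n$, the corresponding orbits $x_{\mathbb Z}(s^0)$ and $x_{\mathbb Z}(s^2)$ lie on a common cycle of length at least $4n$.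
   Context: Hénon map: $f(x,\lambda)=(1+x_2-\lambda x_1^2,\;1.4\,x_1)^T$ on $\mathbb{R}^2$, with fixed point $\xi_+(\lambda)=(\nu(\lambda),1.4\nu(\lambda))^T$, $\nu(\lambda)=\frac1{5\lambda}(1+\sqrt{1+25\lambda})$. At $\tilde\lambda=0.35$ one considers four distinct transversal homoclinic orbits $x^0_{\mathbb Z},x^1_{\mathbb Z},x^2_{\mathbb Z},x^3_{\mathbb Z}$ with respect to $\xi_+(\tilde\lambda)$ which lie on one closed curve of homoclinic orbits (in orbit–parameter space) and pass into each other in the cyclic order $0,1,2,3,0$ via a right turning point between $0$ and $1$ (at parameter $\lambda^{0,1}$), a left turning point between $1$ and $2$ (at $\lambda^{1,2}$), a right turning point between $2$ and $3$ (at $\lambda^{2,3}>\lambda^{0,1}$) and a left turning point between $3$ and $0$ (at $\lambda^{3,0}<\lambda^{1,2}$). $n$-humped orbits: for a sufficiently long integer interval $J=[n_-,n_+]$ around $0$ and $s\in\mathcal S^n$, $x_{\mathbb Z}(s)$ is the true homoclinic $f(\cdot,\tilde\lambda)$-orbit shadowing the concatenated pseudo orbit $x^{s_1}_{(-\infty,n_+]}\,x^{s_2}_J\cdots x^{s_{n-1}}_J\,x^{s_n}_{[n_-,\infty)}$; these orbits are identified with their symbols $s$. Equivalence relation: let $\mathcal H=\{(y_{\mathbb Z},\lambda)\in\ell^\infty(\mathbb{R}^2)\times\mathbb{R}: y_{m+1}=f(y_m,\lambda)\ \forall m\in\mathbb Z,\ \lim_{m\to\pm\infty}y_m=\xi_+(\lambda)\}$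 and let $C(s)$ be the connected component of $\mathcal H$ containing $(x_{\mathbb Z}(s),\tilde\lambda)$. Then $s\cong\bar s$ iff $(x_{\mathbb Z}(\bar s),\tilde\lambda)\in C(s)$. Graph $G$: undirected, vertex set $\mathcal S^n$, edges labeled $L$ or $R$. Let $d$ be the graph distance on the $4$-cycle $0\,1\,2\,3\,0$. There is no edge between $s$ and $\bar s$ if $\sum_{i=1}^nd(s_i,\bar s_i)\neq1$. If $\sum_id(s_i,\bar s_i)=1$, let $j$ be the unique index with $s_j\ne\bar s_j$. Then: – $s,\bar s$ are joined by an $R$-edge if $\{s_j,\bar s_j\}=\{0,1\}$, or if $\{s_j,\bar s_j\}=\{2,3\}$ and $s_i\in\{2,3\}$ for all $i=1,\dots,n$; – $s,\bar s$ are joined by an $L$-edge if $\{s_j,\bar s_j\}=\{1,2\}$, or if $\{s_j,\bar s_j\}=\{0,3\}$ and $s_i\in\{0,3\}$ for all $i=1,\dots,n$; – there are no other edges. An $LR$-cycle is a (simple) cycle in $G$ along which $L$- and $R$-edges alternate cyclically; its length is its number of edges (equal to its number of vertices). An orbit $x_{\mathbb Z}(s)$ lies on a cycle if $s$ is a vertex of that cycle. *)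

(* Defs.v *)
From mathcomp Require Import all_boot all_order all_algebra.
From mathcomp Require Import all_classical all_reals all_analysis.

Set Implicit Arguments.
Unset Strict Implicit.
Unset Printing Implicit Defensive.

Import Order.TTheory GRing.Theory Num.Theory.
Import numFieldNormedType.Exports.

Local Open Scope classical_set_scope.
Local Open Scope ring_scope.

(* Length of a shortest e-path from a to b; the value is #|T| when b is not
   reachable from a. *)
Definition graph_dist (T : finType) (e : rel T) (a b : T) : nat :=
  find (fun k => [exists p : k.-tuple T, path e a p && (last a p == b)])
       (iota 0 #|T|).

Definition symbol := 'I_4.

Definition C4 : rel symbol := fun a b => (b == ordS a) || (a == ordS b).

Definition dist4 : symbol -> symbol -> nat := graph_dist C4.

Definition word (n : nat) := n.-tuple symbol.

Variant label := L_edge | R_edge.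

Definition pair_at n (s t : word n) (j : 'I_n) (a b : symbol) : bool :=
  ([set tnth s j; tnth t j] == [set a; b])%SET.

Definition all_in n (s : word n) (a b : symbol) : bool :=
  [forall i, tnth s i \in [set a; b]%SET].

Definition flip_edge (l : label) n (s t : word n) (j : 'I_n) : bool :=
  match l with
  | R_edge => pair_at s t j 0 1 || (pair_at s t j 2 3 && all_in s 2 3)
  | L_edge => pair_at s t j 1 2 || (pair_at s t j 0 3 && all_in s 0 3)
  end.

Definition edge (l : label) n (s t : word n) : bool :=
  (\sum_(i < n) dist4 (tnth s i) (tnth t i) == 1)%N &&
  [exists j, (tnth s j != tnth t j) && flip_edge l s t j].

(* A simple cycle, given by the list c of its vertices in cyclic order; the
   edge from the i-th vertex to its cyclic successor carries the label lab i. *)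
Definition LR_cycle n (c : seq (word n)) : Prop :=
  [/\ (2 < size c)%N, uniq c &
      exists lab : 'I_(size c) -> label, forall i : 'I_(size c),
        edge (lab i) (tnth (in_tuple c) i) (tnth (in_tuple c) (ordS i)) /\
        lab (ordS i) <> lab i].

Section Henon.
Context {R : realType}.

(* R * R carries the maximum norm. *)
Definition henon (x : R * R) (lam : R) : R * R :=
  (1 + x.2 - lam * x.1 ^+ 2, 14 / 10 * x.1).

Definition nu (lam : R) : R :=
  (5 * lam)^-1 * (1 + Num.sqrt (1 + 25 * lam)).

(* This is a fixed point of henon ^~ lam only when lam >= -1/25 and lam != 0.
   For the remaining parameters, where x^-1 and Num.sqrt return default values,
   xi_plus lam is not a fixed point, hence not the limit of any orbit. *)
Definition xi_plus (lam : R) : R * R := (nu lam, 14 / 10 * nu lam).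

Definition lam_tilde : R := 35 / 100.

Definition is_orbit (lam : R) (y : int -> R * R) : Prop :=
  forall m : int, y (m + 1) = henon (y m) lam.

Definition homoclinic (lam : R) (y : int -> R * R) : Prop :=
  [/\ is_orbit lam y,
      (fun k : nat => y k%:Z) @ \oo --> xi_plus lam &
      (fun k : nat => y (- k%:Z)) @ \oo --> xi_plus lam].

(* Sequences with the topology of uniform convergence; on bounded sequences
   this is the topology of the supremum norm, so that a set of bounded
   sequences has the same connected subsets here and in l^infty(R^2). *)
Local Notation orbit_param := ({uniform int -> (R * R)} * R)%type.

Definition Hset : set orbit_param :=
  [set p | bounded_fun (p.1 : int -> R * R) /\ homoclinic p.2 p.1].

(* The tangent spaces at y 0 of the stable and of the unstable manifold of
   xi_plus lam: the initial values of the solutions of the variational equation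
   along y that decay in forward, resp. backward, time. *)
Definition stable_tangent (lam : R) (y : int -> R * R) : set (R * R) :=
  [set v | exists u : nat -> R * R, [/\ u 0%N = v,
     forall m : nat, u m.+1 = 'd (henon ^~ lam) (y m%:Z) (u m) &
     u @ \oo --> (0 : R * R)]].

Definition unstable_tangent (lam : R) (y : int -> R * R) : set (R * R) :=
  [set v | exists u : nat -> R * R, [/\ u 0%N = v,
     forall m : nat, u m = 'd (henon ^~ lam) (y (- (m.+1)%:Z)) (u m.+1) &
     u @ \oo --> (0 : R * R)]].

Definition transversal (lam : R) (y : int -> R * R) : Prop :=
  forall w : R * R, exists v v',
    [/\ stable_tangent lam y v, unstable_tangent lam y v' & w = v + v'].

Definition rises (g : R -> orbit_param) (a b : R) : Prop :=
  {in `[a, b]%R &, {homo (fun t => (g t).2) : t t' / t < t'}}.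

Definition falls (g : R -> orbit_param) (a b : R) : Prop :=
  {in `[a, b]%R &, {homo (fun t => (g t).2) : t t' / t < t' >-> t' < t}}.

(* A right (left) turning point separates an arc on which the parameter
   increases (decreases) from one on which it decreases (increases). *)
Definition on_closed_curve (x : symbol -> int -> R * R)
    (lam01 lam12 lam23 lam30 : R) : Prop :=
  exists (g : R -> orbit_param) (t01 t1 t12 t2 t23 t3 t30 : R),
  [/\ [/\ {within `[0, 1], continuous g}, g 0 = g 1 &
          forall t, 0 <= t <= 1 -> Hset (g t)],
      [/\ 0 < t01 < t1, t1 < t12 < t2, t2 < t23 < t3 & t3 < t30 < 1],
      [/\ g 0 = (x 0, lam_tilde), g t1 = (x 1, lam_tilde),
          g t2 = (x 2, lam_tilde) & g t3 = (x 3, lam_tilde)],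
      [/\ rises g 0 t01, falls g t01 t12, rises g t12 t23,
          falls g t23 t30 & rises g t30 1] &
      [/\ (g t01).2 = lam01, (g t12).2 = lam12,
          (g t23).2 = lam23 & (g t30).2 = lam30]].

Record four_homoclinics (x : symbol -> int -> R * R)
    (lam01 lam12 lam23 lam30 : R) : Prop := FourHomoclinics {
  four_distinct : injective x;
  four_homoclinic : forall a, homoclinic lam_tilde (x a);
  four_transversal : forall a, transversal lam_tilde (x a);
  four_curve : on_closed_curve x lam01 lam12 lam23 lam30;
  four_right : lam01 < lam23;
  four_left : lam30 < lam12
}.

(* Index (starting from 0) of the hump in which the concatenation with
   J = [nm, np] is at time m: hump k occupies the times nm + k * |J|, ...,
   np + k * |J|, with the first (last) one extended to -oo (+oo). *)
Definition hump_index (n : nat) (nm np m : int) : nat :=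
  if m < nm then 0%N else minn n.-1 `|((m - nm) %/ (np - nm + 1))%Z|%N.

(* x^{s_1}_{(-oo, np]} x^{s_2}_J ... x^{s_{n-1}}_J x^{s_n}_{[nm, +oo)}; the
   first piece keeps its time index. *)
Definition pseudo_orbit n (x : symbol -> int -> R * R) (nm np : int)
    (s : word n) : int -> R * R :=
  fun m => let k := hump_index n nm np m in
           x (nth 0 s k) (m - k%:Z * (np - nm + 1)).

Definition shadows (eps : R) (y z : int -> R * R) : Prop :=
  forall m : int, `|y m - z m| <= eps.

(* J = [nm, np] is long enough for the shadowing radius eps: each concatenation
   is shadowed by exactly one homoclinic orbit, which X assigns to its word. *)
Record humped_orbits n (x : symbol -> int -> R * R) (eps : R) (nm np : int)
    (X : word n -> int -> R * R) : Prop := HumpedOrbits {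
  humped_radius : 0 < eps;
  humped_interval : nm <= 0 <= np;
  humped_homoclinic : forall s, homoclinic lam_tilde (X s);
  humped_shadows : forall s, shadows eps (X s) (pseudo_orbit x nm np s);
  humped_unique : forall s y, homoclinic lam_tilde y ->
    shadows eps y (pseudo_orbit x nm np s) -> y = X s
}.

Definition Ccomp n (X : word n -> int -> R * R) (s : word n) :
    set orbit_param :=
  connected_component Hset (X s, lam_tilde).

Definition hump_equiv n (X : word n -> int -> R * R) (s t : word n) : Prop :=
  Ccomp X s (X t, lam_tilde).

Definition LR_partition n (X : word n -> int -> R * R)
    (P : set (seq (word n))) : Prop :=
  [/\ forall c, P c -> LR_cycle c,
      partition P (fun c => [set` c]) setT &
      [set hump_equiv X s | s in setT] = [set [set` c] | c in P]].

End Henon.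

(* Main.v *)
Require Import Defs.
From mathcomp Require Import all_boot all_order all_algebra.
From mathcomp Require Import all_classical all_reals all_analysis.
From mathcomp Require Import zify.

(* Let an LR-cycle of length m be given.  Each R-edge changes the parity of
   the number of letters in {1, 2} and no L-edge does, so the number m / 2 of
   R-edges is even.  Off the two words 0...0 and 2...2, no edge creates or
   destroys the last letter 3; at 0...0 the R-neighbour has no letter 3 while
   the L-neighbour has one.  Hence a cycle through 0...0 must also pass through
   2...2.  Finally an edge changes the sum of the distances of the letters to 0
   on the 4-cycle by one, and this sum is 0 at 0...0 and 2n at 2...2, so each
   of the two arcs joining these words has at least 2n edges. *)

Local Open Scope classical_set_scope.
Local Open Scope ring_scope.

Set Implicit Arguments.
Unset Strict Implicit.
Unset Printing Implicit Defensive.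

Definition is_R (l : label) : bool := if l is R_edge then true else false.

Lemma is_R_neq (l l' : label) : l <> l' -> is_R l = ~~ is_R l'.
Proof. by case: l l' => [] []. Qed.

(** The search in [graph_dist] already fails at length 0, because the empty path from [a] ends at
    [a]. *)
Lemma dist4_gt0 (a b : symbol) : a != b -> (0 < dist4 a b)%N.
Proof.
move=> ab; rewrite /dist4 /graph_dist card_ord /= ifF //.
by apply/negbTE/existsPn => p; rewrite (tuple0 p).
Qed.

Lemma sum_nat_eq1 (n : nat) (F : 'I_n -> nat) (i j : 'I_n) :
  (\sum_(k < n) F k)%N = 1%N -> (0 < F j)%N -> i != j -> F i = 0%N.
Proof. by move=> + Fj ij; rewrite (bigD1 j) //= (bigD1 i) //=; lia. Qed.

Lemma set2_eq_neq (T : finType) (a b c d : T) :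
  ([set a; b] = [set c; d])%SET -> a != b ->
  (a = c /\ b = d) \/ (a = d /\ b = c).
Proof.
move=> e ab; have := set21 a b; have := set22 a b.
by rewrite !e !inE => /orP[]/eqP eb /orP[]/eqP ea; move: ab;
  rewrite ea eb ?eqxx //; [right|left].
Qed.

Section Words.
Variable n : nat.
Implicit Types (s t : word n) (j : 'I_n).

(** * Edges as changes of a single letter *)

Definition flips l s t j : Prop :=
  [/\ forall i, i != j -> tnth s i = tnth t i,
      tnth s j != tnth t j & flip_edge l s t j].

Lemma edge_flips l s t : edge l s t -> exists j, flips l s t j.
Proof.
case/andP=> /eqP sum1 /existsP [j /andP[neq fl]]; exists j; split=> // i ij.
apply/eqP; apply: contraT => /dist4_gt0.
by rewrite (sum_nat_eq1 sum1 _ ij) // dist4_gt0.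
Qed.

Lemma pair_at_sym s t j a b : pair_at s t j a b = pair_at t s j a b.
Proof. by rewrite /pair_at finset.setUC. Qed.

Lemma all_in_pair s t j a b :
  (forall i, i != j -> tnth s i = tnth t i) ->
  pair_at s t j a b -> all_in s a b -> all_in t a b.
Proof.
move=> off /eqP e /forallP sab; apply/forallP => i.
by have [->|/off <-] := eqVneq i j; [rewrite -e set22|apply: sab].
Qed.

Lemma flips_sym l s t j : flips l s t j -> flips l t s j.
Proof.
case=> off neq fl; split; [by move=> i /off|by rewrite eq_sym|].
by case: l fl => /orP[p|/andP[p q]]; apply/orP; [left|right|left|right];
  rewrite pair_at_sym ?p //= (all_in_pair off p).
Qed.

(** The side condition is recorded for the endpoint whose letter at [j] is not 3; the indices let a
    case analysis fix the colour and both letters at once. *)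
Variant flip_spec (l : label) s t j : bool -> symbol -> symbol -> Prop :=
  | Flip01 : flip_spec l s t j true 0 1
  | Flip10 : flip_spec l s t j true 1 0
  | Flip12 : flip_spec l s t j false 1 2
  | Flip21 : flip_spec l s t j false 2 1
  | Flip23 of all_in s 2 3 : flip_spec l s t j true 2 3
  | Flip32 of all_in t 2 3 : flip_spec l s t j true 3 2
  | Flip03 of all_in s 0 3 : flip_spec l s t j false 0 3
  | Flip30 of all_in t 0 3 : flip_spec l s t j false 3 0.

Lemma flipsP l s t j :
  flips l s t j -> flip_spec l s t j (is_R l) (tnth s j) (tnth t j).
Proof.
case=> off neq; case: l => /orP[p|/andP[p q]];
  have q' := all_in_pair off p;
  by case: (set2_eq_neq (eqP p) neq) => -[-> ->]; constructor; auto.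
Qed.

Lemma flips_sum l s t j (F : symbol -> nat) : flips l s t j ->
  (\sum_(i < n) F (tnth s i) + F (tnth t j) =
   \sum_(i < n) F (tnth t i) + F (tnth s j))%N.
Proof.
case=> off _ _; rewrite (bigD1 j) // [in RHS](bigD1 j) //=.
rewrite (eq_bigr (fun i => F (tnth t i))) => [|i /off -> //]; lia.
Qed.

(** * Parity and height along an edge *)

Definition is_mid (a : symbol) : bool := (a == 1) || (a == 2).

Definition mid_parity s : bool := odd (\sum_(i < n) is_mid (tnth s i))%N.

(** Each of the R-pairs 01 and 23 has exactly one letter in {1, 2}, whereas the L-pair 12 has two
    and the L-pair 03 has none. *)
Lemma mid_parity_edge l s t :
  edge l s t -> mid_parity t = mid_parity s (+) is_R l.
Proof.
case/edge_flips=> j fl; rewrite /mid_parity.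
have := flips_sum (fun a => is_mid a) fl.
by case: (flipsP fl) => /= *; lia.
Qed.

(* The sum of the distances of the letters to 0 on the 4-cycle. *)
Definition height s : nat :=
  (\sum_(i < n) minn (tnth s i) (4 - tnth s i))%N.

Lemma height_edge l s t :
  edge l s t -> (height t <= (height s).+1)%N /\ (height s <= (height t).+1)%N.
Proof.
case/edge_flips=> j fl; rewrite /height.
have := flips_sum (fun a => minn a (4 - a))%N fl.
by case: (flipsP fl) => /= *; lia.
Qed.

Lemma height_nseq (a : symbol) :
  height (nseq_tuple n a) = (n * minn a (4 - a))%N.
Proof.
rewrite /height (eq_bigr (fun=> minn a (4 - a))) => [|i _].
  by rewrite sum_nat_const card_ord.
by rewrite (tnth_nth a) nth_nseq ltn_ord.
Qed.

(** * Gain and loss of the letter 3 *)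

Definition has3 s : bool := [exists i, tnth s i == 3].

Lemma all_in3_nseq s (a : symbol) :
  all_in s a 3 -> ~~ has3 s -> s = nseq_tuple n a.
Proof.
move=> /forallP sa; rewrite negb_exists => /forallP s3.
apply: eq_from_tnth => i; rewrite [RHS](tnth_nth a) nth_nseq ltn_ord.
by have := sa i; rewrite !inE (negbTE (s3 i)) orbF => /eqP.
Qed.

(** A 3 can arise only from a 2 or a 0, and then the side condition confines [s] to {2, 3} or {0,
    3}; having no 3, [s] is constant. *)
Lemma has3_gain l s t j : flips l s t j -> ~~ has3 s -> has3 t ->
  s = nseq_tuple n 0 \/ s = nseq_tuple n 2.
Proof.
move=> fl ns /existsP [i ti3].
have j_only : i = j.
  apply/eqP; apply: contraT => ij; case: fl => off _ _.
  by case/existsP: ns; exists i; rewrite off.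
rewrite {i}j_only in ti3; case: (flipsP fl) ti3 => // sa _.
  by right; apply: all_in3_nseq.
by left; apply: all_in3_nseq.
Qed.

Lemma has3_loss l s t j : flips l s t j -> has3 s -> ~~ has3 t ->
  t = nseq_tuple n 0 \/ t = nseq_tuple n 2.
Proof. by move=> /flips_sym fl h3 n3; apply: (has3_gain fl). Qed.

Lemma has3_flip0 l t j : flips l (nseq_tuple n 0) t j -> has3 t = ~~ is_R l.
Proof.
move=> fl; have s0 i : tnth (nseq_tuple n (0 : symbol)) i = 0.
  by rewrite (tnth_nth 0) nth_nseq ltn_ord.
have tj : tnth t j = if is_R l then 1 else 3.
  by case: (flipsP fl) (s0 j).
case: (is_R l) tj => /= tj; last by apply/existsP; exists j; rewrite tj.
apply/negbTE/existsPn => i; have [->|ij] := eqVneq i j; first by rewrite tj.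
by case: fl => off _ _; rewrite -off // s0.
Qed.

(** * Cycles unrolled into walks *)

Record LR_walk (m : nat) (v : nat -> word n) (l : nat -> label) : Prop := {
  walk_edge : forall i, edge (l i) (v i) (v i.+1);
  walk_alt : forall i, is_R (l i.+1) = ~~ is_R (l i);
  walk_period : v m = v 0%N;
  walk_period_label : is_R (l m) = is_R (l 0%N);
  walk_inj0 : forall i, (i < m)%N -> v i = v 0%N -> i = 0%N
}.

(** Indexing by [nat], modulo the length and starting at [s], turns arcs into index intervals and
    alternation into parity of the index. Simplicity of the cycle survives as [walk_inj0]: no return
    to [s] before time [m]. *)
Lemma LR_cycle_walk (c : seq (word n)) s : LR_cycle c -> s \in c ->
  exists v l, [/\ v 0%N = s, forall i, v i \in c & LR_walk (size c) v l].
Proof.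
case=> c2 uc [lab labP] sc; set m := size c in lab labP *.
have m0 : (0 < m)%N by apply: leq_trans c2.
pose k := index s c; have km : (k < m)%N by rewrite index_mem.
pose o i : 'I_m := Ordinal (ltn_pmod (k + i) m0).
have oS i : ordS (o i) = o i.+1.
  by apply: val_inj; rewrite /= -addn1 modnDml addn1 addnS.
have om : o m = o 0%N by apply: val_inj; rewrite /= modnDr addn0.
have v0 : nth s c (o 0%N) = s by rewrite /= addn0 modn_small // nth_index.
exists (fun i => nth s c (o i)), (fun i => lab (o i)); split=> //.
  by move=> i; apply: mem_nth; apply: ltn_ord.
split=> [i|i|||i im].
- by have [] := labP (o i); rewrite oS !(tnth_nth s).
- by apply: is_R_neq; have [_] := labP (o i); rewrite oS.
- by rewrite -/(o m) om.
- by rewrite -/(o m) om.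
- move/eqP; rewrite (nth_uniq s (ltn_ord _) (ltn_ord _) uc) /= eqn_modDl.
  by rewrite mod0n modn_small // => /eqP.
Qed.

Section Walk.
Context (m : nat) (v : nat -> word n) (l : nat -> label).
Hypothesis walk : LR_walk m v l.

Lemma walk_label i : is_R (l i) = is_R (l 0%N) (+) odd i.
Proof.
elim: i => [|i IH]; first by rewrite addbF.
by rewrite (walk_alt walk) IH /= addbN.
Qed.

(** Two consecutive edges include exactly one R-edge. *)
Lemma walk_mid_parity i : mid_parity (v i.*2) = mid_parity (v 0%N) (+) odd i.
Proof.
elim: i => [|i IH]; first by rewrite addbF.
rewrite doubleS !(mid_parity_edge (walk_edge walk _)) IH (walk_alt walk) /=.
by case: (mid_parity _) (is_R _) (odd _) => [] [] [].
Qed.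

Lemma walk_even : ~~ odd m.
Proof.
have := walk_period_label walk; rewrite walk_label.
by case: (is_R _) (odd m) => [] [].
Qed.

Lemma walk_dvdn4 : (4 %| m)%N.
Proof.
have m2 : m = m./2.*2 by rewrite even_halfK // walk_even.
have := walk_mid_parity m./2; rewrite -m2 (walk_period walk).
have : odd m./2 = false -> (4 %| m)%N by lia.
by case: (odd _) => [_|->] //; case: (mid_parity _).
Qed.

Lemma walk_height i k : (height (v (i + k)) <= height (v i) + k)%N /\
  (height (v i) <= height (v (i + k)) + k)%N.
Proof.
elim: k => [|k IH]; first by rewrite !addn0.
rewrite addnS; have := height_edge (walk_edge walk (i + k)); lia.
Qed.

Hypothesis v0 : v 0%N = nseq_tuple n 0.

Lemma walk_visits2 : (2 < m)%N ->
  exists2 i, (i < m)%N & v i = nseq_tuple n 2.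
Proof.
move=> m2; apply: contrapT => no2.
have away i : (0 < i < m)%N -> v i <> nseq_tuple n 0 /\ v i <> nseq_tuple n 2.
  move=> /andP[i0 im]; split=> [vi|vi]; last by apply: no2; exists i.
  by have := walk_inj0 walk im; rewrite v0 vi => /(_ erefl); lia.
(* Strictly between two visits to 0...0 the walk avoids both exceptional words, so no edge there
   gains or loses the letter 3. *)
have const i : (i.+1 < m)%N -> has3 (v i.+1) = has3 (v 1%N).
  elim: i => // i IH im; rewrite -IH; last by lia.
  have [n0 n2] := away i.+1 ltac:(lia); have [n0' n2'] := away i.+2 ltac:(lia).
  have [j fl] := edge_flips (walk_edge walk i.+1).
  case h : (has3 (v i.+1)); case h' : (has3 (v i.+2)) => //.
  - by case: (has3_loss fl h (negbT h')).
  - by case: (has3_gain fl (negbT h) h').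
have first3 : has3 (v 1%N) = ~~ is_R (l 0%N).
  by have [j] := edge_flips (walk_edge walk 0%N); rewrite v0; apply: has3_flip0.
(* The closing edge enters 0...0; reversed, it is again a flip out of that word. *)
have last3 : has3 (v m.-1) = ~~ is_R (l m.-1).
  have [j] := edge_flips (walk_edge walk m.-1).
  rewrite (_ : m.-1.+1 = m) ?(walk_period walk) ?v0; last by lia.
  by move/flips_sym/has3_flip0.
move: last3; rewrite (_ : m.-1 = m.-2.+1); last by lia.
rewrite const; last by lia.
rewrite first3 (walk_label m.-2.+1) /=.
(* As [m] is even, the first and the closing edge have opposite labels, so exactly one of the two
   neighbours of 0...0 contains a 3, contrary to [const]. *)
have -> : odd m.-2 = false by have := walk_even; lia.
by case: (is_R _).
Qed.

Lemma walk_size i : (i < m)%N -> v i = nseq_tuple n 2 -> (4 * n <= m)%N.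
Proof.
move=> im vi; have := walk_height 0%N i; have := walk_height i (m - i).
rewrite subnKC ?(ltnW im) // add0n (walk_period walk) vi v0.
(* The factors 0 and 2 are the values of [minn a (4 - a)] at these letters, found by computation. *)
have -> : height (nseq_tuple n 0) = (n * 0)%N by rewrite height_nseq.
have -> : height (nseq_tuple n 2) = (n * 2)%N by rewrite height_nseq.
lia.
Qed.

End Walk.
End Words.

Theorem theorem8 (R : realType) (x : symbol -> int -> R * R)
    (lam01 lam12 lam23 lam30 : R)
    (Hx : four_homoclinics x lam01 lam12 lam23 lam30)
    (n : nat) (n_gt0 : (0 < n)%N)
    (eps : R) (nm np : int) (X : word n -> int -> R * R)
    (HX : humped_orbits x eps nm np X)
    (P : set (seq (word n))) (HP : LR_partition X P) :
  (forall s : word n, exists c, [/\ P c, s \in c & (4 %| size c)%N]) /\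
  (exists c, [/\ P c, nseq_tuple n (0 : symbol) \in c,
                 nseq_tuple n (2 : symbol) \in c &
                 (4 * n <= size c)%N]).
Proof.
case: HP => cycP [covP _ _] _.
have cov s : exists2 c, P c & s \in c.
  by have /seteqP[_ /(_ s I)[c]] := covP; exists c.
split=> [s|].
  have [c Pc sc] := cov s; exists c; split=> //.
  by have [v [l [_ _ w]]] := LR_cycle_walk (cycP c Pc) sc; apply: walk_dvdn4 w.
have [c Pc c0] := cov (nseq_tuple n 0); exists c.
have [v [l [v0 vc w]]] := LR_cycle_walk (cycP c Pc) c0.
have [c2 _ _] := cycP c Pc.
have [i im vi] := walk_visits2 w v0 c2.
by split=> //; [rewrite -vi|apply: walk_size w v0 _ im vi].
Qed.
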